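(* Let $f=\frac1n\sum_{i=1}^n f_i$ where each $f_i:\mathbb{R}^d\to\mathbb{R}$ is convex and $L_i$-smooth, and assume that $f$ is $\mu$-strongly convex ($\mu>0$) with minimizer $x^*$. Let $L_{\max}=\max_{1\le i\le n}L_i$, let $c\ge 1/2$, $\gamma_b\in(0,\infty)$, and put $\alpha:=\min\{\frac{1}{2cL_{\max}},\gamma_b\}$. Then the iterates of SGD with $\text{SPS}_{\max}$ (with parameters $c$ and $\gamma_b$) satisfy, for all $k\ge 0$, $$\mathbb{E}\|x^{k}-x^*\|^2\le (1-\mu\alpha)^k\|x^0-x^*\|^2+\frac{2\gamma_b\sigma^2}{\mu\alpha}.$$ Moreover, among all $c\ge 1/2$, the best convergence rate and the tightest neighborhood in this bound (that is, the smallest values of $1-\mu\alpha$ and of $\frac{2\gamma_b\sigma^2}{\mu\alpha}$) are obtained for $c=1/2$.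
   Context: Setting: $f(x)=\frac1n\sum_{i=1}^n f_i(x)$ is minimized over $\mathbb{R}^d$, and the set $\mathcal{X}^*$ of minimizers of $f$ is nonempty. A function is $L$-smooth if it is differentiable with $L$-Lipschitz gradient. For each $i$, $f_i^*:=\inf_x f_i(x)$, and it is assumed throughout that $\sigma^2:=\mathbb{E}_i[f_i(x^* )-f_i^*]=f(x^* )-\frac1n\sum_{i=1}^n f_i^*<\infty$ (so all $f_i^*$ are finite), where $x^*\in\mathcal{X}^*$. SGD: starting from a deterministic $x^0$, at each iteration $k$ an index $i\in\{1,\dots,n\}$ is drawn uniformly at random, independently of the past, and $x^{k+1}=x^k-\gamma_k\nabla f_i(x^k)$. $\text{SPS}_{\max}$ with parameters $c>0$ and $\gamma_b>0$: $\gamma_k=\min\left\{\frac{f_i(x^k)-f_i^*}{c\|\nabla f_i(x^k)\|^2},\gamma_b\right\}$, where $i$ is the index drawn at iteration $k$. If $\nabla f_i(x^k)=0$ then $x^{k+1}=x^k$. *)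

(* Defs.v *)
From HB Require Import structures.
From mathcomp Require Import all_boot all_order all_algebra.
From mathcomp Require Import all_classical all_reals all_analysis.

Set Implicit Arguments.
Unset Strict Implicit.
Unset Printing Implicit Defensive.

Import Order.TTheory GRing.Theory Num.Theory.
Import numFieldNormedType.Exports.

Local Open Scope classical_set_scope.
Local Open Scope ring_scope.

(* The library norm `|x| on 'rV[R]_d is the sup norm, hence this definition. *)
Definition enorm (R : realType) (d : nat) (x : 'rV[R]_d) : R :=
  Num.sqrt (\sum_(j < d) x 0 j ^+ 2).

Definition gradient (R : realType) (d : nat) (g : 'rV[R]_d -> R)
    (x : 'rV[R]_d) : 'rV[R]_d :=
  \row_(j < d) ('D_(delta_mx 0 j) g x).

Definition smooth (R : realType) (d : nat) (L : R) (g : 'rV[R]_d -> R) : Prop :=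
  (forall x, differentiable g x) /\
  (forall x y, enorm (gradient g x - gradient g y) <= L * enorm (x - y)).

Definition strongly_convex (R : realType) (d : nat) (mu : R)
    (g : 'rV[R]_d -> R) : Prop :=
  forall (x y : 'rV[R]_d) (t : R), 0 <= t <= 1 ->
    g (t *: x + (1 - t) *: y) <=
      t * g x + (1 - t) * g y - mu / 2 * (t * (1 - t)) * enorm (x - y) ^+ 2.

Definition minimizer (R : realType) (d : nat) (g : 'rV[R]_d -> R)
    (x : 'rV[R]_d) : Prop :=
  forall y, g x <= g y.

Definition average (R : realType) (d n : nat) (f : 'I_n -> 'rV[R]_d -> R)
    (x : 'rV[R]_d) : R :=
  n%:R^-1 * \sum_(i < n) f i x.

Definition infimum (R : realType) (d : nat) (g : 'rV[R]_d -> R) : \bar R :=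
  ereal_inf [set (g x)%:E | x in [set: 'rV[R]_d]].

(* Extended-real: equal to +oo exactly when some f_i is unbounded below. *)
Definition sigma2 (R : realType) (d n : nat) (f : 'I_n -> 'rV[R]_d -> R)
    (xs : 'rV[R]_d) : \bar R :=
  ((n%:R^-1)%:E * \sum_(i < n) ((f i xs)%:E - infimum (f i)))%E.

(* The seed 0 is harmless: a Lipschitz constant is nonnegative once d > 0. *)
Definition Lmax (R : realType) (n : nat) (L : 'I_n -> R) : R :=
  \big[Num.max/0]_(i < n) L i.

Definition alpha (R : realType) (n : nat) (L : 'I_n -> R) (c gb : R) : R :=
  Num.min (1 / (2 * c * Lmax L)) gb.

Definition sps_max (R : realType) (d : nat) (c gb : R) (g : 'rV[R]_d -> R)
    (x : 'rV[R]_d) : R :=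
  Num.min ((g x - fine (infimum g)) / (c * enorm (gradient g x) ^+ 2)) gb.

Definition sps_step (R : realType) (d : nat) (c gb : R) (g : 'rV[R]_d -> R)
    (x : 'rV[R]_d) : 'rV[R]_d :=
  if gradient g x == 0 then x else x - sps_max c gb g x *: gradient g x.

Fixpoint sgd_sps (R : realType) (d n : nat) (f : 'I_n -> 'rV[R]_d -> R)
    (c gb : R) (x0 : 'rV[R]_d) (idx : nat -> 'I_n) (k : nat) : 'rV[R]_d :=
  if k is k'.+1 then
    sps_step c gb (f (idx k')) (sgd_sps f c gb x0 idx k')
  else x0.

(* Independent uniform draws: the index set 'I_n carries the discrete
   sigma-algebra, and independence is the product rule over every finite set
   of times. *)
Definition iid_uniform (disp : measure_display) (Omega : measurableType disp)
    (R : realType) (P : probability Omega R) (n : nat)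
    (I : nat -> Omega -> 'I_n) : Prop :=
  [/\ forall k (A : set 'I_n), measurable (I k @^-1` A),
      forall k (i : 'I_n), P (I k @^-1` [set i]) = (n%:R^-1)%:E
    & forall (K : seq nat) (A : nat -> set 'I_n), uniq K ->
        P (\bigcap_(k in [set` K]) I k @^-1` A k) =
        (\prod_(k <- K) P (I k @^-1` A k))%E].

(* Main.v *)
(* Write m_i for the infimum of f_i and put
     D_i = f_i(xs) - f_i(x) - <grad f_i(x), xs - x> >= 0.
   For c >= 1/2 the step size satisfies
     gamma^2 |grad f_i(x)|^2 <= 2 gamma (f_i(x) - m_i),
   so expanding the square gives
     |x+ - xs|^2 <= |x - xs|^2 - 2 gamma D_i + 2 gamma (f_i(xs) - m_i).
   Since D_i >= 0 and alpha <= gamma <= gamma_b, gamma can be replaced by alpha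
   in front of D_i and by gamma_b in front of f_i(xs) - m_i; only then is the
   mean over i taken. The mean of the D_i is the Bregman divergence of f, which
   is at least mu/2 |x - xs|^2, so strong convexity is needed for the average
   only. *)
Require Import Defs.
From mathcomp Require Import all_boot all_order all_algebra.
From mathcomp Require Import all_classical all_reals all_analysis.
From mathcomp Require Import ring lra.

Set Implicit Arguments.
Unset Strict Implicit.
Unset Printing Implicit Defensive.

Import Order.TTheory GRing.Theory Num.Theory.
Import numFieldNormedType.Exports.

Local Open Scope classical_set_scope.
Local Open Scope ring_scope.

(** * Euclidean inner product and its norm *)

Definition dot (R : realType) (d : nat) (u v : 'rV[R]_d) : R :=
  \sum_(j < d) u 0 j * v 0 j.

Section Dot.
Variables (R : realType) (d : nat).
Implicit Types (u v w : 'rV[R]_d) (a : R).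

Lemma dotC u v : dot u v = dot v u.
Proof. by apply: eq_bigr => j _; rewrite mulrC. Qed.

Lemma dotDl u v w : dot (u + v) w = dot u w + dot v w.
Proof. by rewrite -big_split; apply: eq_bigr => j _; rewrite mxE mulrDl. Qed.

Lemma dot0l u : dot 0 u = 0.
Proof. by rewrite /dot big1 // => j _; rewrite mxE mul0r. Qed.

Lemma dotZl a u v : dot (a *: u) v = a * dot u v.
Proof. by rewrite mulr_sumr; apply: eq_bigr => j _; rewrite mxE mulrA. Qed.

Lemma dotDr u v w : dot u (v + w) = dot u v + dot u w.
Proof. by rewrite dotC dotDl !(dotC u). Qed.

Lemma dotZr a u v : dot u (a *: v) = a * dot u v.
Proof. by rewrite dotC dotZl dotC. Qed.

Lemma dotNl u v : dot (- u) v = - dot u v.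
Proof. by rewrite -scaleN1r dotZl mulN1r. Qed.

Lemma dotNr u v : dot u (- v) = - dot u v.
Proof. by rewrite dotC dotNl dotC. Qed.

Lemma dot_suml (I : Type) (r : seq I) (F : I -> 'rV[R]_d) v :
  dot (\sum_(i <- r) F i) v = \sum_(i <- r) dot (F i) v.
Proof.
elim/big_rec2: _ => [|i y x _ <-]; last by rewrite dotDl.
exact: dot0l.
Qed.

Lemma dot_ge0 u : 0 <= dot u u.
Proof. by apply: sumr_ge0 => j _; rewrite -expr2 sqr_ge0. Qed.

Lemma enorm_ge0 u : 0 <= enorm u.
Proof. exact: sqrtr_ge0. Qed.

Lemma sqr_enorm u : enorm u ^+ 2 = dot u u.
Proof.
rewrite sqr_sqrtr; first by apply: eq_bigr => j _; rewrite expr2.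
by apply: sumr_ge0 => j _; rewrite sqr_ge0.
Qed.

Lemma enormB u v : enorm (u - v) = enorm (v - u).
Proof. by congr Num.sqrt; apply: eq_bigr => j _; rewrite !mxE -sqrrN opprB. Qed.

Lemma enorm_eq0 u : (enorm u == 0) = (u == 0).
Proof.
apply/idP/eqP => [/eqP u0|->]; last first.
  by rewrite /enorm big1 ?sqrtr0 // => j _; rewrite mxE expr0n.
have /psumr_eq0P u0' : \sum_(j < d) u 0 j ^+ 2 = 0.
  under eq_bigr do rewrite expr2.
  by rewrite -/(dot u u) -sqr_enorm u0 expr0n.
apply/rowP => j; rewrite mxE; apply/eqP.
by rewrite -sqrf_eq0 u0' // => k _; exact: sqr_ge0.
Qed.

(** Cauchy-Schwarz: expand the nonnegative square of [dot v v *: u - dot u v *: v] and divide by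
    [dot v v]. *)
Lemma dot_le_enorm u v : dot u v <= enorm u * enorm v.
Proof.
have [->|v0] := eqVneq v 0.
  by rewrite /dot big1 ?mulr_ge0 ?enorm_ge0 // => j _; rewrite mxE mulr0.
have vv_gt0 : 0 < dot v v.
  by rewrite -sqr_enorm exprn_gt0 // lt0r enorm_eq0 v0 enorm_ge0.
have := dot_ge0 (dot v v *: u - dot u v *: v).
rewrite !(dotDl, dotDr, dotNl, dotNr, dotZl, dotZr) (dotC v u) => ge0.
have cs : dot u v ^+ 2 <= dot u u * dot v v.
  by rewrite -(ler_pM2l vv_gt0); lra.
apply: le_trans (ler_norm _) _.
rewrite -ler_sqr ?nnegrE ?mulr_ge0 ?enorm_ge0 //.
by rewrite real_normK ?num_real // exprMn !sqr_enorm.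
Qed.

End Dot.

(** * One-variable real analysis *)

Section RealLemmas.
Variable R : realType.

Lemma ge0_of_linear_lower_bound (M A : R) :
  (forall t, 0 < t <= 1 -> - (M * t) <= A) -> 0 <= A.
Proof.
move=> lb; rewrite leNgt; apply/negP => A0.
have M1 : 0 < 2 * (`|M| + 1) by have := normr_ge0 M; lra.
(* This [t] is small enough that [M * t] is less than [- A / 2], which contradicts the lower bound
   since [A < 0]. *)
pose t := Num.min 1 (- A / (2 * (`|M| + 1))).
have t0 : 0 < t by rewrite lt_min ltr01 divr_gt0 ?oppr_gt0.
have t1 : t <= 1 by rewrite ge_min lexx.
have : t <= - A / (2 * (`|M| + 1)) by rewrite ge_min lexx orbT.
rewrite ler_pdivlMr // => tA.
have := lb t; rewrite t0 t1 => /(_ isT).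
have : M * t <= `|M| * t by apply: ler_wpM2r (ler_norm _); exact: ltW.
by lra.
Qed.

(** Mean value theorem for [phi] minus the quadratic of slope [dphi 0 + K * t]: the derivative of
    the difference is nonpositive for [t > 0]. This takes the place of integrating [dphi]. *)
Lemma quadratic_upper_bound (phi dphi : R -> R) (K : R) :
  (forall t : R, is_derive t 1 phi (dphi t)) ->
  (forall t, 0 < t -> dphi t - dphi 0 <= K * t) ->
  phi 1 <= phi 0 + dphi 0 + K / 2.
Proof.
move=> der lip.
pose psi t := phi t - (dphi 0 *: id t + (K / 2) *: ((id : R -> R) ^+ 2) t).
have dpsi (t : R) : is_derive t 1 psi (dphi t - (dphi 0 + K * t)).
  apply: is_deriveB; apply: is_derive_eq.
  by rewrite /= expr1 /GRing.scale /= !mulr1; field.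
have [|t t01 eq_psi] := @MVT R psi (fun t => dphi t - (dphi 0 + K * t))
    0 1 ltr01 (fun t _ => dpsi t).
  by apply: derivable_within_continuous => t _; exact: ex_derive.
move: t01; rewrite in_itv /= => /andP[t0 _].
have := lip _ t0; move: eq_psi.
rewrite /psi /= /GRing.scale /= !fctE !expr2; lra.
Qed.

End RealLemmas.

(** * Quadratic bounds for smooth and for convex functions *)

Section Smooth.
Variables (R : realType) (d : nat).
Implicit Types (g : 'rV[R]_d -> R) (x y v : 'rV[R]_d).

Lemma derive_dot_gradient g x v :
  differentiable g x -> 'D_v g x = dot (gradient g x) v.
Proof.
move=> gx; rewrite deriveE // [in LHS](row_sum_delta v) linear_sum.
by apply: eq_bigr => j _; rewrite linearZ mxE deriveE // mulrC.
Qed.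

Lemma is_derive_line g x v (t : R) :
  differentiable g (x + t *: v) ->
  is_derive t 1 (fun s => g (x + s *: v)) (dot (gradient g (x + t *: v)) v).
Proof.
move=> gx; rewrite -derive_dot_gradient //.
have quotE : (fun h : R => h^-1 *: (g (x + (h *: 1 + t) *: v) - g (x + t *: v)))
    = (fun h : R => h^-1 *: (g (h *: v + (x + t *: v)) - g (x + t *: v))).
  apply/funext => h; congr (_ *: (g _ - _)).
  by rewrite scalerDl addrCA /GRing.scale /= mulr1.
split; last by rewrite /derive /= quotE.
rewrite /derivable /= quotE.
exact: diff_derivable.
Qed.

(** Descent lemma: along the segment from [x] to [x + v], Cauchy-Schwarz and the Lipschitz gradient
    let the slope grow by at most [L * enorm v ^+ 2 * t]. *)
Lemma smooth_upper (L : R) g x v :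
  smooth L g -> g (x + v) <= g x + dot (gradient g x) v + L / 2 * enorm v ^+ 2.
Proof.
case=> dg lip.
have := @quadratic_upper_bound R (fun s => g (x + s *: v))
  (fun s => dot (gradient g (x + s *: v)) v) (L * enorm v ^+ 2).
rewrite scale1r scale0r addr0 mulrAC; apply=> [t|t t0].
  exact: is_derive_line.
rewrite -dotNl -dotDl (le_trans (dot_le_enorm _ _)) //.
have := lip (x + t *: v) x; rewrite addrAC subrr add0r.
have -> : enorm (t *: v) = t * enorm v.
  apply/eqP; rewrite -(@eqrXn2 _ 2) ?mulr_ge0 ?enorm_ge0 ?ltW //.
  by rewrite exprMn !sqr_enorm dotZl dotZr mulrA expr2.
move=> le; rewrite expr2 mulrA mulrAC.
apply: ler_wpM2r (enorm_ge0 _) _ _ _; apply: le_trans le _.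
by rewrite mulrA mulrAC.
Qed.

Lemma smoothN (L : R) g : smooth L g -> smooth L (fun x => - g x).
Proof.
move=> [dg lip]; split=> [x|x y]; first exact: differentiableN.
have gradN z : gradient (fun u => - g u) z = - gradient g z.
  by apply/rowP => j; rewrite !mxE deriveN //; exact: diff_derivable.
by rewrite !gradN opprK addrC enormB.
Qed.

Lemma smooth_lower (L : R) g x v :
  smooth L g -> g x + dot (gradient g x) v - L / 2 * enorm v ^+ 2 <= g (x + v).
Proof.
move=> gL; have := smooth_upper x v (smoothN gL).
have -> : dot (gradient (fun u => - g u) x) v = - dot (gradient g x) v.
  have dg := gL.1 x.
  rewrite -!derive_dot_gradient //; last exact: differentiableN.
  by rewrite deriveN //; exact: diff_derivable.
by lra.
Qed.

Lemma smooth_le (L L' : R) g : L <= L' -> smooth L g -> smooth L' g.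
Proof.
move=> LL' [dg lip]; split=> // x y; apply: le_trans (lip x y) _.
by rewrite ler_wpM2r // enorm_ge0.
Qed.

(** A gradient step of length [L^-1] lowers [g] by at least [enorm (gradient g x) ^+ 2 / (2 * L)],
    and the value reached is still at least [m]. *)
Lemma smooth_gradient_gap (L m : R) g x :
  0 < L -> smooth L g -> (forall y, m <= g y) ->
  enorm (gradient g x) ^+ 2 <= 2 * L * (g x - m).
Proof.
move=> L0 gL mg; have := smooth_upper x (- L^-1 *: gradient g x) gL.
move/(le_trans (mg _)); rewrite !sqr_enorm !(dotZl, dotZr).
set q := dot _ _ => le_m.
have {}le_m : m <= g x - q / (2 * L).
  apply: le_trans le_m _; rewrite le_eqVlt; apply/orP; left.
  by apply/eqP; field; lra.
have {le_m} : q / (2 * L) <= g x - m by lra.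
by rewrite ler_pdivrMr ?mulr_gt0 // mulrC.
Qed.

(* Allowing any p with a quadratic minorant, instead of the gradient, avoids
   differentiating the average of the f_i. *)
Lemma strongly_convex_first_order (mu K : R) g x p :
  strongly_convex mu g ->
  (forall v, g x + dot p v - K * enorm v ^+ 2 <= g (x + v)) ->
  forall y, g x + dot p (y - x) + mu / 2 * enorm (y - x) ^+ 2 <= g y.
Proof.
move=> gmu lb y; rewrite -subr_ge0.
apply: (@ge0_of_linear_lower_bound _ ((mu / 2 + K) * enorm (y - x) ^+ 2)).
move=> t /andP[t0 t1].
have := lb (t *: (y - x)); rewrite dotZr.
have -> : x + t *: (y - x) = t *: y + (1 - t) *: x.
  by rewrite scalerBr scalerBl scale1r addrCA.
have t01 : 0 <= t <= 1 by rewrite ltW.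
move/le_trans => /(_ _ (gmu y x t t01)).
have -> : enorm (t *: (y - x)) ^+ 2 = t ^+ 2 * enorm (y - x) ^+ 2.
  by rewrite !sqr_enorm dotZl dotZr mulrA expr2.
set q := enorm (y - x) ^+ 2; set D := dot _ _ => le.
rewrite -(ler_pM2l t0); move: le; rewrite expr2; lra.
Qed.

(** Convexity is strong convexity with modulus 0, and smoothness supplies the quadratic minorant. *)
Lemma convex_first_order (L : R) g x y :
  smooth L g -> convex_function [set: 'rV[R]_d] g ->
  g x + dot (gradient g x) (y - x) <= g y.
Proof.
move=> gL cvx; have g0 : strongly_convex 0 g.
  move=> u v t /andP[t0 t1]; rewrite mul0r mul0r mul0r subr0.
  by apply: (cvx (Itv01 t0 t1) u v); rewrite inE.
have := strongly_convex_first_order g0 (fun v => smooth_lower x v gL) y.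
by rewrite !mul0r addr0.
Qed.

End Smooth.

(** * First-order bounds for the average of the functions *)

Section Average.
Variables (R : realType) (d n : nat) (f : 'I_n -> 'rV[R]_d -> R).
Variables (L : 'I_n -> R).
Hypothesis f_smooth : forall i, smooth (L i) (f i).

Lemma Lmax_ge0 : 0 <= Lmax L.
Proof.
by rewrite /Lmax; elim/big_rec: _ => // i z _ z0; rewrite le_max z0 orbT.
Qed.

Lemma le_Lmax i : L i <= Lmax L.
Proof. by rewrite /Lmax (bigD1 i) //= le_max lexx. Qed.

(** Stands in for the gradient of [average f]. *)
Let G x := n%:R^-1 *: \sum_(i < n) gradient (f i) x.

Hypothesis n_gt0 : (0 < n)%N.

Lemma mean_affine (a b : 'I_n -> R) (e : R) :
  n%:R^-1 * \sum_(i < n) (a i + b i + e) =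
  n%:R^-1 * (\sum_(i < n) a i) + n%:R^-1 * (\sum_(i < n) b i) + e.
Proof.
have n0 : n%:R != 0 :> R by rewrite pnatr_eq0 -lt0n.
by rewrite !big_split /= sumr_const card_ord !mulrDr -(mulr_natl e) mulKf.
Qed.

Lemma average_upper x v :
  average f (x + v) <= average f x + dot (G x) v + Lmax L / 2 * enorm v ^+ 2.
Proof.
rewrite dotZl dot_suml -mean_affine ler_pM2l ?invr_gt0 ?ltr0n //.
by apply: ler_sum => i _; exact/smooth_upper/(smooth_le (le_Lmax i)).
Qed.

Lemma average_lower x v :
  average f x + dot (G x) v - Lmax L / 2 * enorm v ^+ 2 <= average f (x + v).
Proof.
rewrite dotZl dot_suml -mean_affine ler_pM2l ?invr_gt0 ?ltr0n //.
by apply: ler_sum => i _; exact/smooth_lower/(smooth_le (le_Lmax i)).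
Qed.

Lemma average_first_order (mu : R) x y :
  strongly_convex mu (average f) ->
  average f x + dot (G x) (y - x) + mu / 2 * enorm (y - x) ^+ 2 <= average f y.
Proof.
by move=> fmu; exact: strongly_convex_first_order fmu (average_lower x) y.
Qed.

(** The quadratic lower and upper bounds of [average f] around 0 are compared at a unit vector,
    which exists because [d] is positive. It makes [Lmax L] positive and the contraction factor
    nonnegative. *)
Lemma mu_le_Lmax (mu : R) :
  (0 < d)%N -> strongly_convex mu (average f) -> mu <= Lmax L.
Proof.
move=> d0 fmu; pose e : 'rV[R]_d := delta_mx 0 (Ordinal d0).
have e2 : 0 < enorm e ^+ 2.
  rewrite exprn_gt0 // lt0r enorm_ge0 andbT enorm_eq0; apply/eqP => /rowP.
  by move/(_ (Ordinal d0))/eqP; rewrite !mxE !eqxx oner_eq0.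
have := average_first_order 0 e fmu; rewrite subr0.
have := average_upper 0 e; rewrite add0r => up lo.
by have := le_trans lo up; rewrite lerD2l ler_pM2r // ler_pM2r.
Qed.

End Average.

(** * One step of the method for a single function *)

Section Step.
Variables (R : realType) (d : nat).

Lemma sps_step_bound (L c gb m : R) (g : 'rV[R]_d -> R) (x xs : 'rV[R]_d) :
  0 < L -> 1 / 2 <= c -> 0 < gb -> smooth L g -> Defs.infimum g = m%:E ->
  (forall y, g x + dot (gradient g x) (y - x) <= g y) ->
  enorm (sps_step c gb g x - xs) ^+ 2 <=
    enorm (x - xs) ^+ 2
    - 2 * Num.min (1 / (2 * c * L)) gb
        * (g xs - (g x + dot (gradient g x) (xs - x)))
    + 2 * gb * (g xs - m).
Proof.
move=> L0 c2 gb0 gL infm cvx.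
have le_m y : m <= g y.
  by rewrite -lee_fin -infm; apply: ereal_inf_lbound; exists y.
set a := Num.min _ gb; set D := g xs - _.
have D0 : 0 <= D by rewrite subr_ge0.
have a_gb : a <= gb by rewrite ge_min lexx orbT.
(* With a zero gradient the point stays in place, and the claim reduces to
   [a * D <= gb * (g xs - m)]. *)
rewrite /sps_step; have [g0|g0] := eqVneq.
  have gxm : g x <= m.
    rewrite -lee_fin -infm; apply/ereal_infP => _ [y _ <-].
    by rewrite lee_fin; have := cvx y; rewrite g0 dot0l addr0.
  have aD : a * D <= gb * D by rewrite ler_wpM2r.
  have : gb * D <= gb * (g xs - m).
    by rewrite ler_pM2l // /D g0 dot0l addr0 lerB.
  lra.
set G := gradient g x in g0 *.
have G0 : 0 < enorm G ^+ 2 by rewrite exprn_gt0 // lt0r enorm_eq0 g0 enorm_ge0.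
have c0 : 0 < c by lra.
have cG : 0 < c * enorm G ^+ 2 by rewrite mulr_gt0.
have gap := smooth_gradient_gap x L0 gL le_m; rewrite -/G in gap.
set s := sps_max c gb g x.
have sE : s = Num.min ((g x - m) / (c * enorm G ^+ 2)) gb.
  by rewrite /s /sps_max infm.
have s_gb : s <= gb by rewrite sE ge_min lexx orbT.
(* Inserting [gap] into the Polyak quotient bounds it below by [1 / (2 * c * L)]. *)
have a_s : a <= s.
  rewrite sE /a le_min ge_min; apply/andP; split; last exact: a_gb.
  apply/orP; left; rewrite ler_pdivlMr //.
  rewrite (_ : 1 / _ * _ = enorm G ^+ 2 / (2 * L)).
    by rewrite ler_pdivrMr ?mulr_gt0 // mulrC.
  by field; rewrite !lt0r_neq0.
have a0 : 0 <= a by rewrite le_min divr_ge0 ?mulr_ge0 ?ltW.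
have s0 : 0 <= s := le_trans a0 a_s.
(* The definition of [s] gives [c * s * enorm G ^+ 2 <= g x - m]; the condition [1 / 2 <= c] turns
   [c] into [1 / 2]. *)
have s_gap : s * enorm G ^+ 2 <= 2 * (g x - m).
  have : s <= (g x - m) / (c * enorm G ^+ 2) by rewrite sE ge_min lexx.
  rewrite ler_pdivlMr //.
  have : 0 <= (c - 1 / 2) * (s * enorm G ^+ 2).
    by rewrite mulr_ge0 ?subr_ge0 // mulr_ge0 // ltW.
  lra.
have -> : enorm (x - s *: G - xs) ^+ 2 =
    enorm (x - xs) ^+ 2 + 2 * s * dot G (xs - x) + s * (s * enorm G ^+ 2).
  rewrite !sqr_enorm !(dotDl, dotDr, dotNl, dotNr, dotZl, dotZr).
  by rewrite (dotC G x) (dotC G xs) (dotC xs x); ring.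
have sD : a * D <= s * D by rewrite ler_wpM2r.
have sm : s * (g xs - m) <= gb * (g xs - m) by rewrite ler_wpM2r // subr_ge0.
have ss : s * (s * enorm G ^+ 2) <= s * (2 * (g x - m)) by rewrite ler_wpM2l.
by rewrite /D -/G in sD *; lra.
Qed.

End Step.

(** * Expectations along random draws, by finite histories *)

Section Cylinders.
Variables (disp : measure_display) (Omega : measurableType disp).
Variables (R : realType) (P : probability Omega R) (n : nat).
Variable I : nat -> Omega -> 'I_n.
Hypothesis n_gt0 : (0 < n)%N.
Hypothesis I_iid : iid_uniform P I.

Let i0 := Ordinal n_gt0.

(** Integrating over these events replaces conditioning on the past. The default [i0] is never read,
    since [j < size t]. *)
Definition cylinder (t : seq 'I_n) : set Omega :=
  [set w | forall j, (j < size t)%N -> I j w = nth i0 t j].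

Lemma cylinder_bigcap t :
  cylinder t = \bigcap_(j in [set` iota 0 (size t)]) I j @^-1` [set nth i0 t j].
Proof.
apply/seteqP; split=> w wt j /= jt; apply: wt => //=; last by rewrite mem_iota.
by move: jt; rewrite mem_iota.
Qed.

Lemma measurable_draw k (A : set 'I_n) : measurable (I k @^-1` A).
Proof. by case: I_iid => + _ _; exact. Qed.

Lemma measurable_cylinder t : measurable (cylinder t).
Proof.
rewrite cylinder_bigcap; apply: fin_bigcap_measurable => // j _.
exact: measurable_draw.
Qed.

Lemma prob_cylinder t : P (cylinder t) = (n%:R^-1 ^+ size t)%:E.
Proof.
case: I_iid => _ unif indep.
rewrite cylinder_bigcap indep ?iota_uniq //.
under eq_bigr do rewrite unif.
by rewrite prodEFin big_const_seq count_predT iter_mulr_1 size_iota.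
Qed.

Lemma cylinder_rcons t i :
  cylinder (rcons t i) = cylinder t `&` I (size t) @^-1` [set i].
Proof.
apply/seteqP; split=> w; rewrite /cylinder /= size_rcons.
  move=> wt; split; last by rewrite wt // nth_rcons ltnn eqxx.
  by move=> j jt; rewrite wt ?nth_rcons ?jt // ltnS ltnW.
move=> [wt wi] j; rewrite ltnS leq_eqVlt nth_rcons.
by case/predU1P => [->|jt]; rewrite ?ltnn ?eqxx // jt wt.
Qed.

(** Split according to the value of the next draw, in the form required for additivity of the
    integral. *)
Lemma cylinder_partition t :
  cylinder t = \big[setU/set0]_(i <- index_enum 'I_n) cylinder (rcons t i).
Proof.
rewrite -bigcup_seq; apply/seteqP; split=> [w wt|w [i _]].
  by exists (I (size t) w); rewrite /= ?mem_index_enum // cylinder_rcons.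
by rewrite cylinder_rcons => -[].
Qed.

Lemma trivIset_cylinder_rcons t (D : set 'I_n) :
  trivIset D (fun i => cylinder (rcons t i)).
Proof.
apply/trivIsetP => i j _ _ /eqP ij; rewrite !cylinder_rcons -subset0.
by move=> w [[_ /= wi] [_ /= wj]]; apply: ij; rewrite -wi.
Qed.

Variables (d : nat) (f : 'I_n -> 'rV[R]_d -> R) (c gb : R).

Lemma sgd_sps_shift x idx k :
  sgd_sps f c gb x idx k.+1 =
  sgd_sps f c gb (sps_step c gb (f (idx 0%N)) x) (fun j => idx j.+1) k.
Proof. by elim: k => //= k ->. Qed.

(** [phi] can be arbitrary: the iterate depends on finitely many draws from a finite set, so the
    function is a finite combination of indicators, built up one draw at a time. *)
Lemma measurable_sgd_sps (phi : 'rV[R]_d -> R) x m k :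
  measurable_fun [set: Omega]
    (fun w => phi (sgd_sps f c gb x (fun j => I (m + j) w) k)).
Proof.
elim: k m x => [|k IHk] m x; first exact: (measurable_cst (phi x)).
pose F i w := \1_(I m @^-1` [set i]) w *
  phi (sgd_sps f c gb (sps_step c gb (f i) x) (fun j => I (m.+1 + j) w) k).
rewrite (_ : (fun w => _) = fun w => \sum_(i < n) F i w).
  apply: measurable_sum => i.
  apply: measurable_realfun.measurable_funM; last exact: IHk.
  exact/measurable_realfun.measurable_indic/measurable_draw.
apply/funext => w; rewrite sgd_sps_shift addn0 (bigD1 (I m w)) //= big1.
  rewrite /F indicE mem_set //= mul1r addr0.
  by congr (phi (sgd_sps _ _ _ _ _ _)); apply/funext => j; rewrite addSnnS.
by move=> i /eqP iI; rewrite /F indicE memNset ?mul0r //= => /esym.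
Qed.

(* Splitting off the first draw instead of the last keeps the claim inductive:
   the bound B k is affected only through its starting point. *)
Lemma integral_cylinder_le (h : 'rV[R]_d -> R) (B : nat -> 'rV[R]_d -> R) :
  (forall x, 0 <= h x) -> (forall x, h x <= B 0 x) ->
  (forall k x,
    n%:R^-1 * \sum_(i < n) B k (sps_step c gb (f i) x) <= B k.+1 x) ->
  forall k t x,
  (\int[P]_(w in cylinder t)
      (h (sgd_sps f c gb x (fun j => I (size t + j) w) k))%:E
   <= (n%:R^-1 ^+ size t * B k x)%:E)%E.
Proof.
move=> h0 hB step; elim=> [|k IHk] t x.
  rewrite (integral_cst P (measurable_cylinder t) (h x)%:E).
  rewrite [X in (_ * X)%E](prob_cylinder t) -EFinM lee_fin mulrC.
  by rewrite ler_wpM2l // exprn_ge0 // invr_ge0.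
rewrite cylinder_partition ge0_integral_bigsetU //.
- apply: le_trans (_ : (\sum_(i < n)
    (n%:R^-1 ^+ (size t).+1 * B k (sps_step c gb (f i) x))%:E <= _)%E).
    (* On [cylinder (rcons t i)] the next draw is [i], so the run continues for [k] steps from
       [sps_step c gb (f i) x]. The longer history accounts for the extra factor [n%:R^-1]. *)
    apply: lee_sum => i _; have := IHk (rcons t i) (sps_step c gb (f i) x).
    rewrite size_rcons; apply: le_trans; rewrite le_eqVlt; apply/orP; left.
    apply/eqP/eq_integral => w.
    rewrite inE cylinder_rcons sgd_sps_shift addn0 => -[_ /= ->].
    by congr (h (sgd_sps _ _ _ _ _ _))%:E; apply/funext => j; rewrite addSnnS.
  by rewrite sumEFin lee_fin -mulr_sumr exprSr -mulrA ler_wpM2l ?step.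
- by move=> i; exact: measurable_cylinder.
- exact: index_enum_uniq.
- exact: trivIset_cylinder_rcons.
- apply: (@measurable_funS _ _ _ _ setT) => //.
  apply/measurable_realfun.measurable_EFinP; exact: measurable_sgd_sps.
- by move=> w _; rewrite lee_fin.
Qed.

Lemma expectation_sgd_sps_le (h : 'rV[R]_d -> R) (B : nat -> 'rV[R]_d -> R) :
  (forall x, 0 <= h x) -> (forall x, h x <= B 0 x) ->
  (forall k x,
    n%:R^-1 * \sum_(i < n) B k (sps_step c gb (f i) x) <= B k.+1 x) ->
  forall k x,
  ('E_P[fun w => h (sgd_sps f c gb x (fun j => I j w) k)] <= (B k x)%:E)%E.
Proof.
move=> h0 hB step k x; rewrite unlock.
have := integral_cylinder_le h0 hB step k [::] x; rewrite expr0 mul1r.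
by rewrite (_ : cylinder [::] = setT) //; apply/seteqP; split.
Qed.

End Cylinders.

(** * Finiteness and sign of the noise term *)

Section Sigma2.
Variables (R : realType) (d n : nat) (f : 'I_n -> 'rV[R]_d -> R).
Variable xs : 'rV[R]_d.

Lemma infimum_le (g : 'rV[R]_d -> R) x : (Defs.infimum g <= (g x)%:E)%E.
Proof. by apply: ereal_inf_lbound; exists x. Qed.

(** An infimum equal to [-oo] produces a summand [+oo], and no other summand is [-oo] because every
    infimum is below a real value; [sigma2] would then be [+oo]. *)
Lemma infimum_fin_num i :
  (0 < n)%N -> (sigma2 f xs < +oo)%E -> Defs.infimum (f i) \is a fin_num.
Proof.
move=> n_gt0.
have lty j : (Defs.infimum (f j) < +oo)%E.
  exact: le_lt_trans (infimum_le _ xs) (ltry _).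
rewrite fin_numElt lty andbT ltNye; apply: contraTN => /eqP infNy.
rewrite /sigma2 (_ : \sum_(j < n) _ = +oo)%E.
  by rewrite gt0_muley ?ltxx // lte_fin invr_gt0 ltr0n.
apply/esum_eqyP => [j _|]; last first.
  by exists i; rewrite mem_index_enum infNy.
by move: (lty j); case: (Defs.infimum (f j)).
Qed.

Hypothesis infimum_fin : forall i, Defs.infimum (f i) \is a fin_num.

Lemma fine_sigma2 : fine (sigma2 f xs) =
  n%:R^-1 * \sum_(i < n) (f i xs - fine (Defs.infimum (f i))).
Proof.
rewrite /sigma2; under eq_bigr do rewrite -(fineK (infimum_fin _)).
by rewrite sumEFin.
Qed.

Lemma fine_sigma2_ge0 : 0 <= fine (sigma2 f xs).
Proof.
rewrite fine_sigma2 mulr_ge0 ?invr_ge0 //; apply: sumr_ge0 => i _.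
by rewrite subr_ge0 -lee_fin fineK // infimum_le.
Qed.

End Sigma2.

(** * Mean contraction in one step *)

Section Contraction.
Variables (R : realType) (d n : nat) (f : 'I_n -> 'rV[R]_d -> R).
Variables (L : 'I_n -> R) (mu gb c : R) (xs : 'rV[R]_d).
Hypothesis n_gt0 : (0 < n)%N.
Hypothesis f_convex : forall i, convex_function [set: 'rV[R]_d] (f i).
Hypothesis f_smooth : forall i, smooth (L i) (f i).
Hypothesis f_sconvex : strongly_convex mu (average f).
Hypothesis infimum_fin : forall i, Defs.infimum (f i) \is a fin_num.

Lemma mean_sps_step_le x : 0 < Lmax L -> 0 < gb -> 1 / 2 <= c ->
  n%:R^-1 * \sum_(i < n) enorm (sps_step c gb (f i) x - xs) ^+ 2 <=
    (1 - mu * alpha L c gb) * enorm (x - xs) ^+ 2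
    + 2 * gb * fine (sigma2 f xs).
Proof.
move=> L0 gb_gt0 c_ge; set a := alpha L c gb.
have c0 : 0 < c by lra.
have a0 : 0 <= a by rewrite le_min divr_ge0 ?mulr_ge0 ?ltW.
pose m i := fine (Defs.infimum (f i)).
have n1 : 0 < n%:R^-1 :> R by rewrite invr_gt0 ltr0n.
pose D i := f i xs - (f i x + dot (gradient (f i) x) (xs - x)).
have step_le : n%:R^-1 * \sum_(i < n) enorm (sps_step c gb (f i) x - xs) ^+ 2 <=
    n%:R^-1 * \sum_(i < n) (- (2 * a) * D i + 2 * gb * (f i xs - m i)
      + enorm (x - xs) ^+ 2).
  rewrite ler_pM2l //; apply: ler_sum => i _.
  have inff : Defs.infimum (f i) = (m i)%:E by rewrite fineK.
  have cvx y := convex_first_order x y (f_smooth i) (f_convex i).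
  (* Using the common constant [Lmax L] gives the same coefficient [a] for every [i], so it factors
     out of the mean. *)
  have := sps_step_bound xs L0 c_ge gb_gt0
    (smooth_le (le_Lmax L i) (f_smooth i)) inff cvx.
  by rewrite -/(alpha L c gb) -/a /D; lra.
apply: le_trans step_le _.
rewrite mean_affine // -!mulr_sumr (mulrCA _ (- (2 * a))) (mulrCA _ (2 * gb)).
rewrite -(fine_sigma2 xs infimum_fin).
have mean_D : n%:R^-1 * (\sum_(i < n) D i) =
    average f xs - (average f x
      + dot (n%:R^-1 *: \sum_(i < n) gradient (f i) x) (xs - x)).
  by rewrite dotZl dot_suml -mulrDr -mulrBr -big_split /= -sumrB.
(* The mean of the [D i] is at least [mu / 2 * enorm (x - xs) ^+ 2]; multiplied by [2 * a], this is
   the gain [mu * a]. *)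
have := average_first_order f_smooth n_gt0 x xs f_sconvex.
rewrite mean_D (enormB xs x); set A := average f xs; set E := _ + dot _ _.
move=> le_A.
have : a * (mu / 2 * enorm (x - xs) ^+ 2) <= a * (A - E).
  by rewrite ler_wpM2l //; lra.
lra.
Qed.

End Contraction.

(** * Iteration of the one-step bound, and its dependence on [c] *)

Theorem theorem3p1 (R : realType) (d n : nat) (n_gt0 : (0 < n)%N)
  (f : 'I_n -> 'rV[R]_d -> R) (L : 'I_n -> R) (mu gb : R)
  (xs x0 : 'rV[R]_d)
  (disp : measure_display) (Omega : measurableType disp)
  (P : probability Omega R) (I : nat -> Omega -> 'I_n)
  (f_convex : forall i, convex_function [set: 'rV[R]_d] (f i))
  (f_smooth : forall i, smooth (L i) (f i))
  (mu_gt0 : 0 < mu)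
  (f_sconvex : strongly_convex mu (average f))
  (xs_min : minimizer (average f) xs)
  (sigma2_fin : (sigma2 f xs < +oo)%E)
  (gb_gt0 : 0 < gb)
  (I_iid : iid_uniform P I) :
  (forall c : R, 1 / 2 <= c -> forall k : nat,
    ('E_P[fun w => (enorm (sgd_sps f c gb x0 (fun j => I j w) k - xs) ^+ 2)%R]
     <= ((1 - mu * alpha L c gb) ^+ k * enorm (x0 - xs) ^+ 2
         + 2 * gb * fine (sigma2 f xs) / (mu * alpha L c gb))%:E)%E) /\
  (forall c : R, 1 / 2 <= c ->
    1 - mu * alpha L (1 / 2) gb <= 1 - mu * alpha L c gb /\
    2 * gb * fine (sigma2 f xs) / (mu * alpha L (1 / 2) gb)
      <= 2 * gb * fine (sigma2 f xs) / (mu * alpha L c gb)).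
Proof.
have infimum_fin i := infimum_fin_num i n_gt0 sigma2_fin.
have sg0 := fine_sigma2_ge0 xs infimum_fin.
have L0 := Lmax_ge0 L.
have alpha_ge0 c : 1 / 2 <= c -> 0 <= alpha L c gb.
  move=> c2; have c0 : 0 <= c by lra.
  by rewrite le_min divr_ge0 ?mulr_ge0 // ltW.
split=> [c c2 k|c c2]; last first.
  have c0 : 0 < c by lra.
  have le_alpha : alpha L c gb <= alpha L (1 / 2) gb.
    rewrite /alpha le_min !ge_min lexx orbT andbT; apply/orP; left.
    rewrite !div1r [leLHS]invfM [leRHS]invfM ler_wpM2r ?invr_ge0 //.
    by rewrite lef_pV2 ?posrE ?mulr_gt0 ?invr_gt0 //; lra.
  split; first by rewrite lerD2l lerN2 ler_pM2l.
  (* If [Lmax L] is 0, the convention [1 / 0 = 0] makes [alpha] vanish for every [c], and the two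
     neighborhoods coincide. *)
  have [Lmax0|Lmax_neq0] := eqVneq (Lmax L) 0.
    have alpha0 e : alpha L e gb = 0.
      by rewrite /alpha Lmax0 mulr0 invr0 mulr0 min_l // ltW.
    by rewrite !alpha0.
  have Lmax_gt0 : 0 < Lmax L by rewrite lt0r Lmax_neq0.
  have alpha_gt0 : 0 < alpha L c gb.
    by rewrite lt_min gb_gt0 divr_gt0 ?mulr_gt0.
  have alpha_gt0' := lt_le_trans alpha_gt0 le_alpha.
  rewrite ler_wpM2l //; first by rewrite mulr_ge0 // mulr_ge0 // ltW.
  by rewrite lef_pV2 ?posrE ?mulr_gt0 // ler_pM2l.
have a0 := alpha_ge0 c c2; set a := alpha L c gb in a0 *.
have [gb0 mu0] := (ltW gb_gt0, ltW mu_gt0).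
have C0 : 0 <= 2 * gb * fine (sigma2 f xs) / (mu * a).
  by rewrite divr_ge0 // ?mulr_ge0 // mulr_ge0.
(* In dimension 0 the constants L i may all be negative, so that Lmax L = 0 and
   alpha, with 1 / 0 = 0, vanishes. *)
have [d0|d_gt0] := posnP d.
  have en0 (u : 'rV[R]_d) : enorm u = 0.
    by rewrite /enorm big1 ?sqrtr0 // => j; move: (ltn_ord j); rewrite {2}d0.
  rewrite unlock (eq_integral (cst 0%E)) ?integral0; last first.
    by move=> w _; rewrite en0 expr0n.
  by rewrite lee_fin en0 expr0n mulr0 add0r.
have c0 : 0 < c by lra.
have mu_L := mu_le_Lmax f_smooth n_gt0 d_gt0 f_sconvex.
have {}L0 : 0 < Lmax L by lra.
have a_gt0 : 0 < a by rewrite lt_min gb_gt0 divr_gt0 ?mulr_gt0.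
(* Here [mu * a <= Lmax L * a <= 2 * c * Lmax L * a <= 1], the middle inequality by [1 / 2 <= c]. *)
have ma1 : mu * a <= 1.
  have : a <= 1 / (2 * c * Lmax L) by rewrite ge_min lexx.
  rewrite ler_pdivlMr ?mulr_gt0 // => aL.
  have : mu * a <= Lmax L * a by rewrite ler_pM2r.
  have : 0 <= (c - 1 / 2) * (Lmax L * a).
    by rewrite mulr_ge0 ?subr_ge0 // mulr_ge0 // ltW.
  lra.
set C := _ / _ in C0 *; set r := 1 - mu * a.
have r0 : 0 <= r by rewrite subr_ge0.
have CE : C * (mu * a) = 2 * gb * fine (sigma2 f xs).
  by rewrite mulfVK // mulf_neq0 // lt0r_neq0.
(* Exact solution of the recursion: [C] is the fixed point of adding the noise [C * (1 - r)] after
   contracting by [r]. The term [- C * r ^+ j] makes [B 0] equal to the squared distance and is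
   dropped at the end. *)
pose B j x := r ^+ j * enorm (x - xs) ^+ 2 + C * (1 - r ^+ j).
apply: (@le_trans _ _ (B k x0)%:E); last first.
  by rewrite lee_fin lerD2l ler_piMr // gerBl exprn_ge0.
apply: (expectation_sgd_sps_le n_gt0 I_iid (h := fun x => enorm (x - xs) ^+ 2)).
- by move=> x; exact: sqr_ge0.
- by move=> x; rewrite /B expr0 mul1r subrr mulr0 addr0.
move=> j x; have := mean_sps_step_le xs n_gt0 f_convex f_smooth f_sconvex
  infimum_fin x L0 gb_gt0 c2.
rewrite -/a -CE -/r => /(ler_wpM2l (exprn_ge0 j r0)).
rewrite /B big_split /= sumr_const card_ord -mulr_sumr -(mulr_natl (C * _)).
rewrite [X in _ -> X <= _]mulrDr mulKf ?pnatr_eq0 -?lt0n //.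
rewrite (mulrCA n%:R^-1) (exprS r).
have -> : mu * a = 1 - r by rewrite /r; lra.
lra.
Qed.
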